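(* Let $\lambda>0$ and let $u(\lambda)$ be the unique root of $U_\lambda(s)=0$ on $[0,1]$. For any $i\ge 0$, the vector $(\phi^*_{ij}(\lambda);\ 0\le j\le c-1)$ is the unique solution of the following system of $c$ linear equations: $$-\lambda\phi^*_{i0}(\lambda)-\sum_{k=1}^{c-1}u(\lambda)^{k-1}\big[B_c(u(\lambda))-B_k(u(\lambda))\big]\phi^*_{ik}(\lambda)=-u(\lambda)^i,$$ $$-\lambda\phi^*_{i0}(\lambda)+b_0\phi^*_{i1}(\lambda)=-\delta_{i0}\quad(\text{present when } c\ge 2),$$ and, for each $1\le j\le c-2$, $$\sum_{k=1}^{j-1}\phi^*_{ik}(\lambda)b_{j-k+1}+[b_1-(j-1)b_0-\lambda]\phi^*_{ij}(\lambda)+(j+1)b_0\phi^*_{i,j+1}(\lambda)=-\delta_{ij}.$$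
   Context: Let $\mathbf E=\{0,1,2,\dots\}$ and let $c\ge 1$ be an integer (the number of servers). Let $(b_j)_{j\ge0}$ be reals with $b_j\ge 0$ for $j\ne 1$, $0<-b_1=\sum_{j\ne1}b_j<\infty$, $b_0>0$ and $\sum_{j\ge2}b_j>0$. The stopped $M^X/M/c$ queue has the conservative bounded $q$-matrix $Q^*=(q^*_{ij};\ i,j\in\mathbf E)$ given by $q^*_{i,i-1}=\min(i,c)b_0$, $q^*_{ii}=b_1-[\min(i,c)-1]b_0$, $q^*_{ij}=b_{j-i+1}$ ($j\ge i+1$) for $i\ge1$, and $q^*_{ij}=0$ otherwise (so state $0$ is absorbing). Let $(p^*_{ij}(t))$ be its (unique) transition function and $\phi^*_{ij}(\lambda)=\int_0^\infty e^{-\lambda t}p^*_{ij}(t)\,dt$ ($\lambda>0$) its resolvent. Define $B(s)=\sum_{j\ge0}b_js^j$, $B_i(s)=B(s)+(i-1)b_0(1-s)$ for $i=1,\dots,c$, and $U_\lambda(s)=B_c(s)-\lambda s$. For each $\lambda>0$ the equation $U_\lambda(s)=0$ has exactly one root $u(\lambda)$ on $[0,1]$, and $0<u(\lambda)<1$. Empty sums are $0$; $\delta$ is the Kronecker delta. *)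

(* Defs.v *)
From HB Require Import structures.
From mathcomp Require Import all_boot all_order all_algebra.
From mathcomp Require Import all_classical all_reals all_analysis.

Set Implicit Arguments.
Unset Strict Implicit.
Unset Printing Implicit Defensive.

Import Order.TTheory GRing.Theory Num.Theory.
Import numFieldNormedType.Exports.

Local Open Scope classical_set_scope.
Local Open Scope ring_scope.

(* The series are taken in \bar R, so that equating one with a real number
   also says that it converges. *)
Record batch_rates (R : realType) (b : nat -> R) : Prop := BatchRates {
  batch_rates_ge0 : forall j, j != 1%N -> 0 <= b j;
  batch_rates_conservative :
    (\sum_(0 <= j <oo | j != 1%N) (b j)%:E = (- b 1%N)%:E)%E;
  batch_rates_1 : 0 < - b 1%N;
  batch_rates_0 : 0 < b 0%N;
  batch_rates_arrival : (0 < \sum_(2 <= j <oo) (b j)%:E)%E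
}.

Definition queue_qmatrix (R : realType) (c : nat) (b : nat -> R)
    (i j : nat) : R :=
  if i == 0%N then 0
  else if i == j.+1 then (minn i c)%:R * b 0%N
  else if i == j then b 1%N - ((minn i c)%:R - 1) * b 0%N
  else if (i < j)%N then b (j - i + 1)%N
  else 0.

(* Standard, possibly dishonest, transition functions on the countable state
   space nat; the values of p i j at negative times are unconstrained. *)
Record transition_function (R : realType) (p : nat -> nat -> R -> R) : Prop :=
  TransitionFunction {
  transition_ge0 : forall i j (t : R), 0 <= t -> 0 <= p i j t;
  transition_le1 : forall i (t : R), 0 <= t ->
    (\sum_(0 <= j <oo) (p i j t)%:E <= 1)%E;
  transition_at0 : forall i j, p i j 0 = (i == j)%:R;
  transition_chapman_kolmogorov : forall i j (s t : R), 0 <= s -> 0 <= t ->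
    (\sum_(0 <= k <oo) (p i k s * p k j t)%:E = (p i j (s + t))%:E)%E;
  transition_standard : forall i j, p i j t @[t --> 0^'+] --> ((i == j)%:R : R)
}.

Definition has_qmatrix (R : realType) (p : nat -> nat -> R -> R)
    (q : nat -> nat -> R) : Prop :=
  forall i j, (p i j t - (i == j)%:R) / t @[t --> 0^'+] --> q i j.

Definition resolvent (R : realType) (p : nat -> nat -> R -> R) (lambda : R)
    (i j : nat) : R :=
  (\int[lebesgue_measure]_(t in `[0%R, +oo[) (expR (- lambda * t) * p i j t))%R.

Definition genfun (R : realType) (b : nat -> R) (s : R) : R :=
  limn (pseries b s).

Definition genfun_servers (R : realType) (b : nat -> R) (i : nat) (s : R) : R :=
  genfun b s + (i%:R - 1) * b 0%N * (1 - s).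

Definition U (R : realType) (c : nat) (b : nat -> R) (lambda s : R) : R :=
  genfun_servers b c s - lambda * s.

Record solves_system (R : realType) (c : nat) (b : nat -> R) (lambda u : R)
    (i : nat) (x : c.-tuple R) : Prop := SolvesSystem {
  system_root :
    - lambda * x`_0
      - \sum_(1 <= k < c)
          u ^+ (k - 1) * (genfun_servers b c u - genfun_servers b k u) * x`_k
    = - u ^+ i;
  system_0 : (2 <= c)%N ->
    - lambda * x`_0 + b 0%N * x`_1 = - (i == 0%N)%:R;
  system_j : forall j, (1 <= j)%N -> (j + 2 <= c)%N ->
    \sum_(1 <= k < j) x`_k * b (j - k + 1)%N
      + (b 1%N - (j%:R - 1) * b 0%N - lambda) * x`_j
      + (j + 1)%:R * b 0%N * x`_(j + 1)
    = - (i == j)%:R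
}.

(* Main.v *)
Require Import Defs.
From mathcomp Require Import all_boot all_order all_algebra.
From mathcomp Require Import all_classical all_reals all_analysis.
From mathcomp Require Import measurable_realfun zify ring lra.

Set Implicit Arguments.
Unset Strict Implicit.
Unset Printing Implicit Defensive.

Import Order.TTheory GRing.Theory Num.Theory.
Import numFieldNormedType.Exports.

Local Open Scope classical_set_scope.
Local Open Scope ring_scope.

(** Write phi_k for the resolvent entry from the fixed initial state i to k. The
  linear system is a finite piece of the forward equation
    lambda phi_j - delta_ij = sum_k phi_k q_kj,
  which holds for every transition function whose q-matrix is bounded on the
  diagonal ([forward_resolvent_cvg]). The equations indexed by j <= c - 2 are
  literally the columns j of the forward equation. The equation containing u
  collects all the columns at once: multiplying column j by u^j and summing
  over j gives, since row k >= 1 of the q-matrix has the generating function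
  s^(k-1) B_(min(k,c))(s),
    lambda phi_0 + sum_(k>=1) lambda u^k phi_k - u^i
      = sum_(k>=1) phi_k u^(k-1) B_(min(k,c))(u);
  as B_c(u) = lambda u, the terms with k >= c cancel and only c unknowns remain
  ([forward_root_equation]). The columns are summed only up to N, and the error
  is at most a constant times u^N, because u < 1.

  The forward equation is obtained without differentiating the transition
  function at positive times. By Chapman-Kolmogorov,
    sum_k phi_k p_kj(h)
      = int_0^oo exp(- lambda t) p_ij(t + h) dt
      = exp(lambda h) (phi_j - int_0^h exp(- lambda t) p_ij(t) dt).
  Subtracting phi_j and dividing by h, the right-hand side tends to
  lambda phi_j - delta_ij as h decreases to 0. On the left-hand side the series
  may be cut at any n > j, uniformly in h, since p_kj(h) <= - q_kk h for k <> j
  and sum_k phi_k converges ([forward_truncation]). The bound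
  1 - p_kk(h) <= - q_kk h comes from the subadditivity of 1 - p_kk, and it also
  makes each p_ij Lipschitz, hence measurable.

  For uniqueness, let z solve the homogeneous system with z_0 >= 0. Adding the
  columns 0, .., J expresses (J + 1) b_0 z_(J+1) as a combination of z_0, .., z_J
  with nonnegative coefficients, because b_0 + .. + b_n <= 0 for n >= 1
  ([homogeneous_columns_ge0]). So all z_k are nonnegative. The equation
  containing u then equates to 0 a sum of nonnegative terms, one of which is
  lambda z_0, whence z_0 = 0, and the columns determine everything from z_0. *)

(** * Laplace transforms of bounded Lipschitz functions *)

Section laplace.
Context {R : realType}.
Variable lambda : R.
Hypothesis lambda0 : 0 < lambda.
Local Notation mu := (@lebesgue_measure R).

(** [resolvent p lambda i j] is convertible to [laplace lambda (p i j)], so the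
    facts below apply to it directly. *)
Definition laplace (f : R -> R) : R :=
  \int[mu]_(t in `[0%R, +oo[) (expR (- lambda * t) * f t).

Definition unit_valued (f : R -> R) := forall t, 0 <= t -> 0 <= f t <= 1.

Definition halfline_lipschitz (M : R) (f : R -> R) :=
  forall s h, 0 <= s -> 0 <= h -> `|f (s + h) - f s| <= M * h.

Lemma halfline_lipschitz_ge0 M f : halfline_lipschitz M f -> 0 <= M.
Proof.
by move=> /(_ 0 1 (lexx _) ler01); rewrite mulr1; apply: le_trans.
Qed.

Lemma halfline_lipschitz_dist M f s t : halfline_lipschitz M f -> 0 <= s -> 0 <= t ->
  `|f s - f t| <= M * `|s - t|.
Proof.
move=> fL s0 t0; wlog st : s t s0 t0 / t <= s.
  move=> H; have [/H|/ltW /H] := leP t s; first exact.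
  by rewrite distrC (distrC s); exact.
by rewrite [X in _ * X]ger0_norm ?subr_ge0// -[in f s](subrKC t s) fL ?subr_ge0.
Qed.

(** One-sided continuity at 0 is all that is available: nothing is known about the
    function at negative times. *)
Lemma halfline_lipschitz_continuous M f : halfline_lipschitz M f ->
  {within `[0, +oo[, continuous f}.
Proof.
move=> fL; have M0 := halfline_lipschitz_ge0 fL.
have cvg_at (F : set_system R) (x : R) : Filter F -> 0 <= x -> F --> x ->
    (\forall y \near F, 0 <= y) -> f y @[y --> F] --> f x.
  move=> FF x0 Fx F0; apply/cvgrPdist_le => e e0; near=> y.
  have y0 : 0 <= y by near: y.
  apply: le_trans (halfline_lipschitz_dist fL x0 y0) _.
  rewrite (@le_trans _ _ ((M + 1) * `|x - y|))// ?ler_wpM2r ?lerDl//.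
  rewrite -ler_pdivlMl ?ltr_pwDr//; near: y.
  move/cvgrPdist_le : Fx; apply.
  by rewrite mulr_gt0 ?invr_gt0 ?ltr_pwDr.
apply/continuous_within_itvcyP; split.
  move=> x; rewrite in_itv/= andbT => x0; apply: cvg_at; rewrite ?ltW//.
  near=> y; apply: ltW; near: y; exact: lt_nbhsr.
apply: cvg_at => //; first exact: cvg_at_right_filter.
by near=> y.
Unshelve. all: by end_near. Qed.

Lemma continuous_expRM : continuous (fun t : R => expR (- lambda * t)).
Proof.
move=> x; apply: continuous_comp; last exact: continuous_expR.
exact: mulrl_continuous.
Qed.

Lemma laplace_integrand_continuous M f : halfline_lipschitz M f ->
  {within `[0, +oo[, continuous (fun t => expR (- lambda * t) * f t)}.
Proof.
move=> fL x; apply: cvgM.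
  by apply: continuous_subspaceT; exact: continuous_expRM.
exact: (halfline_lipschitz_continuous fL).
Qed.

Lemma integral_expRM :
  (\int[mu]_(t in `[0%R, +oo[) (expR (- lambda * t))%:E = (lambda^-1)%:E)%E.
Proof.
have : (\int[mu]_t ((EFin \o (fun t : R => lambda * expR (- lambda * t))%R)
    \_ `[0%R, +oo[) t = 1)%E.
  by rewrite restrict_EFin; exact: integral_exponential_pdf lambda0.
rewrite -integral_mkcond/=; under eq_integral do rewrite EFinM.
rewrite ge0_integralZl//; last 2 first.
- apply/measurable_EFinP; apply: measurable_funTS.
  exact: continuous_measurable_fun continuous_expRM.
- by rewrite lee_fin ltW.
move=> /(congr1 (fun x => (lambda^-1)%:E * x)%E).
by rewrite muleA -EFinM mulVf ?gt_eqF// mul1e mule1.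
Qed.

Lemma measurable_laplace_integrand M f : halfline_lipschitz M f ->
  measurable_fun `[0:R, +oo[ (fun t => expR (- lambda * t) * f t).
Proof.
move=> /laplace_integrand_continuous; apply: subspace_continuous_measurable_fun.
exact: measurable_itv.
Qed.

Lemma integrable_laplace_integrand M f : halfline_lipschitz M f -> unit_valued f ->
  mu.-integrable `[0:R, +oo[ (EFin \o (fun t => expR (- lambda * t) * f t)).
Proof.
move=> fL f1; apply: (@le_integrable _ _ _ mu _ _ _
  (EFin \o (fun t => expR (- lambda * t)))) => //.
- by apply/measurable_EFinP; exact: measurable_laplace_integrand fL.
- move=> t /=; rewrite in_itv/= andbT => t0; rewrite lee_fin.
  rewrite normrM ler_piMr// ger0_norm; by case/andP: (f1 _ t0).
apply/integrableP; split.
  apply/measurable_EFinP; apply: measurable_funTS.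
  exact: continuous_measurable_fun continuous_expRM.
under eq_integral do rewrite /= ger0_norm ?expR_ge0//.
by rewrite integral_expRM ltry.
Qed.

Lemma EFin_laplace M f : halfline_lipschitz M f -> unit_valued f ->
  (laplace f)%:E = (\int[mu]_(t in `[0%R, +oo[) (expR (- lambda * t) * f t)%:E)%E.
Proof.
move=> fL f1; rewrite fineK//; apply: integrable_fin_num => //.
exact: integrable_laplace_integrand fL f1.
Qed.

Lemma laplace_ge0 f : unit_valued f -> 0 <= laplace f.
Proof.
move=> f1; apply: Rintegral_ge0 => t /=; rewrite in_itv/= andbT => t0.
by rewrite mulr_ge0 ?expR_ge0//; case/andP: (f1 _ t0).
Qed.

Lemma laplaceZr M f r : halfline_lipschitz M f -> unit_valued f ->
  laplace (fun t => f t * r) = laplace f * r.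
Proof.
move=> fL f1; rewrite /laplace -RintegralZr//.
  by apply: eq_Rintegral => t _; rewrite mulrA.
exact: integrable_laplace_integrand fL f1.
Qed.

Lemma laplace_sum_le (f : nat -> R -> R) (M : nat -> R) n :
  (forall k, halfline_lipschitz (M k) (f k)) -> (forall k, unit_valued (f k)) ->
  (forall t, 0 <= t -> \sum_(0 <= k < n) f k t <= 1) ->
  \sum_(0 <= k < n) laplace (f k) <= lambda^-1.
Proof.
move=> fL f1 fs; rewrite -lee_fin -sumEFin.
under eq_bigr => k _ do rewrite (EFin_laplace (fL k) (f1 k)).
rewrite -ge0_integral_sum//; last 2 first.
- by move=> k; apply/measurable_EFinP; exact: measurable_laplace_integrand (fL k).
- move=> k t /=; rewrite in_itv/= andbT => t0.
  by rewrite lee_fin mulr_ge0 ?expR_ge0//; case/andP: (f1 k _ t0).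
rewrite -integral_expRM; apply: ge0_le_integral => //.
- move=> t /=; rewrite in_itv/= andbT => t0; apply: sume_ge0 => k _.
  by rewrite lee_fin mulr_ge0 ?expR_ge0//; case/andP: (f1 k _ t0).
- apply: emeasurable_sum => k.
  by apply/measurable_EFinP; exact: measurable_laplace_integrand (fL k).
- apply/measurable_EFinP; apply: measurable_funTS.
  exact: continuous_measurable_fun continuous_expRM.
- move=> t /=; rewrite in_itv/= andbT => t0.
  by rewrite sumEFin lee_fin -mulr_sumr ler_piMr ?expR_ge0// fs.
Qed.

(** The Lipschitz bounds serve only to make all the integrands measurable, so
    they may depend on the index; the exchange itself is monotone convergence. *)
Lemma laplace_series (f : nat -> R -> R) (g : R -> R) (M : nat -> R) N :
  (forall k, halfline_lipschitz (M k) (f k)) -> (forall k, unit_valued (f k)) ->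
  halfline_lipschitz N g -> unit_valued g ->
  (forall t, 0 <= t -> (\sum_(0 <= k <oo) (f k t)%:E = (g t)%:E)%E) ->
  (\sum_(0 <= k <oo) (laplace (f k))%:E = (laplace g)%:E)%E.
Proof.
move=> fL f1 gL g1 fg; rewrite (EFin_laplace gL g1).
transitivity (\int[mu]_(t in `[0%R, +oo[) (\sum_(0 <= k <oo)
    (expR (- lambda * t) * f k t)%:E))%E; last first.
  apply: eq_integral => t; rewrite inE/= in_itv/= andbT => t0.
  rewrite EFinM -(fg _ t0) -nneseriesZl//; last first.
    by move=> k _; rewrite lee_fin; case/andP: (f1 k _ t0).
rewrite integral_nneseries//.
- by apply: eq_eseriesr => k _; rewrite (EFin_laplace (fL k) (f1 k)).
- by move=> k; apply/measurable_EFinP; exact: measurable_laplace_integrand (fL k).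
- move=> k t /=; rewrite in_itv/= andbT => t0.
  by rewrite lee_fin mulr_ge0 ?expR_ge0//; case/andP: (f1 k _ t0).
Qed.

(** The substitution t -> t + h turns the transform of the shifted function into
    an integral over the half-line from h. *)
Lemma laplace_shift M f h : halfline_lipschitz M f -> unit_valued f -> 0 <= h ->
  laplace (fun t => f (t + h)) = expR (lambda * h) *
    (laplace f - \int[mu]_(t in `[0%R, h]) (expR (- lambda * t) * f t)).
Proof.
move=> fL f1 h0.
have intf := integrable_laplace_integrand fL f1.
rewrite /laplace Rintegral_itvB// Rintegral_itv_obnd_cbnd; last first.
  apply: integrableS intf => //; apply: subset_itvr.
  by rewrite bnd_simp.
have fhL : halfline_lipschitz M (fun t => f (t + h)).
  by move=> s k s0 k0; rewrite addrAC fL// addr_ge0.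
have fh1 : unit_valued (fun t => f (t + h)) by move=> t t0; rewrite f1// addr_ge0.
have DF : derive1 (fun t : R => t + h) = cst 1.
  by apply/funext => x; rewrite derive1E;
    exact: (congr1 (fun g => g x) (derive_shift 1 h)).
have -> : \int[mu]_(t in `[h, +oo[) (expR (- lambda * t) * f t) =
    \int[mu]_(t in `[0%R, +oo[)
      (expR (- lambda * h) * (expR (- lambda * t) * f (t + h))).
  have := @increasing_ge0_integration_by_substitutiony _ (fun t => t + h)
    (fun t => expR (- lambda * t) * f t) 0.
  rewrite /= add0r /Rintegral => ->.
  - congr fine; apply: eq_integral => t _; congr EFin.
    by rewrite DF !fctE/= mulr1 mulrDr expRD mulrCA mulrA.
  - by move=> x y _ _; rewrite ltrD2r.
  - by rewrite DF => ? _; exact: cst_continuous.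
  - by rewrite DF; exact: is_cvg_cst.
  - by rewrite DF; exact: is_cvg_cst.
  - split; first by move=> x _; exact: derivableD.
    by apply: cvg_at_right_filter; apply: cvgD; [exact: cvg_id|exact: cvg_cst].
  - exact: cvg_addrr.
  - apply: continuous_subspaceW (laplace_integrand_continuous fL).
    by apply: subset_itvr; rewrite bnd_simp.
  - move=> t; rewrite in_itv/= andbT => ht.
    rewrite mulr_ge0 ?expR_ge0//.
    by case/andP: (f1 t (le_trans h0 (ltW ht))).
rewrite RintegralZl//; last exact: integrable_laplace_integrand fhL fh1.
by rewrite mulrA -expRD mulNr addrN expR0 mul1r.
Qed.

Lemma integral_initial_le M f h : halfline_lipschitz M f -> unit_valued f -> 0 <= h ->
  expR (- lambda * h) * (f 0 - M * h) * h <=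
   \int[mu]_(t in `[0%R, h]) (expR (- lambda * t) * f t) <= (f 0 + M * h) * h.
Proof.
move=> fL f1 h0.
have intf : mu.-integrable `[0:R, h] (EFin \o (fun t => expR (- lambda * t) * f t)).
  apply: integrableS (integrable_laplace_integrand fL f1) => //.
  exact: subset_itvl.
have intc (r : R) : mu.-integrable `[0:R, h] (EFin \o cst r).
  apply: continuous_compact_integrable; first exact: segment_compact.
  by apply: continuous_subspaceT; exact: cst_continuous.
have int_cst (r : R) : \int[mu]_(t in `[0%R, h]) r = r * h.
  rewrite Rintegral_cst//= lebesgue_measure_itv/= lte_fin.
  by case: ltgtP h0 => //= [_|<-]; rewrite ?subr0 ?addr0.
have fb t : 0 <= t <= h -> f 0 - M * h <= f t <= f 0 + M * h.
  move=> /andP[t0 th]; have := fL 0 t (lexx _) t0; rewrite add0r => ft.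
  have {}ft : `|f t - f 0| <= M * h.
    by rewrite (le_trans ft)// ler_wpM2l// (halfline_lipschitz_ge0 fL).
  by rewrite -ler_distl.
rewrite -(int_cst (f 0 + M * h)).
rewrite -(int_cst (expR (- lambda * h) * (f 0 - M * h))).
apply/andP; split; (apply: le_Rintegral => //; first exact: intc) => t /=;
  rewrite in_itv/= => /[dup] th /andP[t0 th'].
- have /andP[ft _] := fb _ th.
  apply: (@le_trans _ _ (expR (- lambda * h) * f t)).
    by rewrite ler_wpM2l ?expR_ge0.
  apply: ler_wpM2r; first by case/andP: (f1 _ t0).
  by rewrite ler_expR ler_wnM2l// oppr_le0 ltW.
- have /andP[_ H] := fb _ th; rewrite (le_trans _ H)// ler_piMl//.
    by case/andP: (f1 _ t0).
  by rewrite -expR0 ler_expR mulNr oppr_le0 mulr_ge0// ltW.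
Qed.

Lemma expRM_slope_cvg : (expR (lambda * h) - 1) / h @[h --> 0^'+] --> lambda.
Proof.
have dE : is_derive (0 : R) 1 (fun h => expR (lambda * h)) lambda.
  by apply: is_derive_eq; rewrite mulr0 expR0 mul1r /GRing.scale/= mulr1.
have [dv de] := dE.
have /cvg_dnbhs_at_right :
    h^-1 *: (((fun h : R => expR (lambda * h)) \o shift 0) (h *: 1) -
    expR (lambda * 0)) @[h --> (0:R)^'] --> lambda.
  by rewrite -[X in _ --> X]de; exact: dv.
apply: cvg_trans; apply: near_eq_cvg; near=> h.
by rewrite /= mulr0 expR0 addr0 /GRing.scale/= mulr1 mulrC.
Unshelve. all: by end_near. Qed.

Lemma expRM_cvg_at_right r : expR (r * h) @[h --> (0:R)^'+] --> (1:R).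
Proof.
rewrite -[X in _ --> X]expR0 -[X in _ --> expR X](mulr0 r).
apply: cvg_at_right_filter.
apply: continuous_comp; last exact: continuous_expR.
exact: mulrl_continuous.
Qed.

Lemma integral_initial_cvg M f : halfline_lipschitz M f -> unit_valued f ->
  (\int[mu]_(t in `[0%R, h]) (expR (- lambda * t) * f t)) / h @[h --> 0^'+] -->
  f 0.
Proof.
move=> fL f1.
have Mh0 : M * h @[h --> (0:R)^'+] --> (0:R).
  by rewrite -[X in _ --> X](mulr0 M); apply: cvg_at_right_filter;
    exact: mulrl_continuous.
apply: (@squeeze_cvgr _ _ _ _ (fun h => expR (- lambda * h) * (f 0 - M * h))
  (fun h => f 0 + M * h)).
- near=> h; have h0 : 0 < h by [].
  by rewrite ler_pdivlMr// ler_pdivrMr// (integral_initial_le fL)// ltW.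
- have : expR (- lambda * h) * (f 0 - M * h) @[h --> (0:R)^'+] --> 1 * (f 0 - 0).
    apply: cvgM; first exact: expRM_cvg_at_right.
    by apply: cvgB => //; exact: cvg_cst.
  by rewrite subr0 mul1r.
- rewrite -[X in _ --> X]addr0.
  by apply: cvgD => //; exact: cvg_cst.
Unshelve. all: by end_near. Qed.

(** This is the rule that the transform of the derivative of f is
    [lambda * laplace f - f 0], with the difference quotient kept outside the
    limit, so that f need not be differentiable. *)
Lemma laplace_slope_cvg M f : halfline_lipschitz M f -> unit_valued f ->
  (laplace (fun t => f (t + h)) - laplace f) / h @[h --> 0^'+] -->
  lambda * laplace f - f 0.
Proof.
move=> fL f1.
have : (expR (lambda * h) - 1) / h * laplace f - expR (lambda * h) *
   ((\int[mu]_(t in `[0%R, h]) (expR (- lambda * t) * f t)) / h)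
   @[h --> 0^'+] --> lambda * laplace f - 1 * f 0.
  apply: cvgB.
    by apply: cvgM; [exact: expRM_slope_cvg|exact: cvg_cst].
  by apply: cvgM; [exact: expRM_cvg_at_right|exact: integral_initial_cvg fL f1].
rewrite mul1r; apply: cvg_trans; apply: near_eq_cvg; near=> h.
have h0 : 0 < h by [].
by rewrite (laplace_shift fL f1 (ltW h0)); ring.
Unshelve. all: by end_near. Qed.

End laplace.

(** * Series with nonnegative terms *)

Section nonnegative_series.
Context {R : realType}.
Implicit Types f : nat -> R.

Lemma series_ge0_nondecreasing f : (forall k, 0 <= f k) ->
  nondecreasing_seq (series f).
Proof.
move=> f0 m n mn; rewrite -subr_ge0 sub_series_geq//; exact: sumr_ge0.
Qed.

Lemma series_ge0_le_lim f l n : (forall k, 0 <= f k) ->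
  series f @ \oo --> l -> series f n <= l.
Proof.
move=> f0 fl; rewrite -(cvg_lim _ fl)//; apply: nondecreasing_cvgn_le.
  exact: series_ge0_nondecreasing.
by apply/cvg_ex; exists l.
Qed.

Lemma nneseries_cvg f l : (forall k, 0 <= f k) ->
  (\sum_(0 <= k <oo) (f k)%:E = l%:E)%E -> series f @ \oo --> l.
Proof.
move=> f0 fl.
have /fine_cvgP[_] : (\sum_(0 <= k < n) (f k)%:E)%E @[n --> \oo] --> l%:E.
  by rewrite -fl; apply: is_cvg_nneseries => k _ _; rewrite lee_fin.
by apply: cvg_trans; apply: near_eq_cvg; apply: nearW => n /=; rewrite sumEFin.
Qed.

Lemma nneseries_le_sum f l n : (forall k, 0 <= f k) ->
  (\sum_(0 <= k <oo) (f k)%:E <= l%:E)%E -> \sum_(0 <= k < n) f k <= l.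
Proof.
move=> f0; rewrite -lee_fin -sumEFin; apply: le_trans.
by apply: nneseries_lim_ge => k _ _; rewrite lee_fin.
Qed.

Lemma ge0_le_sum f n k : (forall k, 0 <= f k) -> (k < n)%N ->
  f k <= \sum_(0 <= j < n) f j.
Proof.
move=> f0 kn; rewrite big_mkord (bigD1 (Ordinal kn))//= lerDl.
exact: sumr_ge0.
Qed.

Lemma ge0_le_sum2 f n k l : (forall k, 0 <= f k) -> (k < n)%N -> (l < n)%N ->
  k != l -> f k + f l <= \sum_(0 <= j < n) f j.
Proof.
move=> f0 kn ln kl; rewrite big_mkord (bigD1 (Ordinal kn))//= lerD2l.
rewrite (bigD1 (Ordinal ln))/=; last by rewrite -val_eqE/= eq_sym.
by rewrite lerDl sumr_ge0.
Qed.

End nonnegative_series.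

(** * The forward equation for the resolvent *)

Section transition.
Context {R : realType}.
Variables (p : nat -> nat -> R -> R) (q : nat -> nat -> R).
Hypothesis pT : transition_function p.
Hypothesis pq : has_qmatrix p q.

Let p0 := transition_ge0 pT.

Lemma transition_sum_le1 i n t : 0 <= t -> \sum_(0 <= j < n) p i j t <= 1.
Proof.
move=> t0; apply: nneseries_le_sum; first by move=> k; exact: p0.
exact: transition_le1.
Qed.

Lemma transition_unit_valued i j : unit_valued (p i j).
Proof.
move=> t t0; rewrite p0//=; apply: le_trans (transition_sum_le1 i j.+1 t0).
by apply: (@ge0_le_sum _ (fun j => p i j t)) => // k; exact: p0.
Qed.

Lemma transition_off_diag i j t : i != j -> 0 <= t -> p i j t <= 1 - p i i t.
Proof.
move=> ij t0; rewrite lerBrDl.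
apply: le_trans (transition_sum_le1 i (maxn i j).+1 t0).
apply: (@ge0_le_sum2 _ (fun j => p i j t)) => //; first by move=> k; exact: p0.
  by rewrite ltnS leq_maxl.
by rewrite ltnS leq_maxr.
Qed.

Lemma chapman_kolmogorov_cvg i j s t : 0 <= s -> 0 <= t ->
  series (fun k => p i k s * p k j t) @ \oo --> p i j (s + t).
Proof.
move=> s0 t0; apply: nneseries_cvg; first by move=> k; rewrite mulr_ge0 ?p0.
exact: transition_chapman_kolmogorov.
Qed.

Lemma chapman_kolmogorov_ge i j k s t : 0 <= s -> 0 <= t ->
  p i k s * p k j t <= p i j (s + t).
Proof.
move=> s0 t0.
have pp0 l : 0 <= p i l s * p l j t by rewrite mulr_ge0 ?p0.
have := (series_ge0_le_lim k.+1 pp0 (@chapman_kolmogorov_cvg i j _ _ s0 t0)).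
apply: le_trans; exact: (ge0_le_sum pp0).
Qed.

(** By Chapman-Kolmogorov p_ii(s + t) >= p_ii(s) p_ii(t), and
    1 - xy <= (1 - x) + (1 - y) on the unit interval. *)
Lemma transition_diag_subadditive i n t : 0 <= t ->
  1 - p i i (n%:R * t) <= n%:R * (1 - p i i t).
Proof.
move=> t0; elim: n => [|n IH].
  by rewrite !mul0r transition_at0// eqxx subrr.
have nt0 : 0 <= n%:R * t by rewrite mulr_ge0.
rewrite -addn1 natrD !mulrDl !mul1r.
have := chapman_kolmogorov_ge i i i nt0 t0.
have /andP[a0 a1] := transition_unit_valued i i nt0.
have /andP[b0 b1] := transition_unit_valued i i t0.
have : 0 <= (1 - p i i (n%:R * t)) * (1 - p i i t).
  by rewrite mulr_ge0 ?subr_ge0.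
rewrite mulrBl mulrBr; lra.
Qed.

(** By subadditivity, 1 - p_ii(t) is at most n (1 - p_ii(t/n)) for every n, and
    the latter tends to - q_ii t. A bound valid at all times thus follows from
    the derivative at time 0. *)
Lemma transition_diag_ge i t : 0 <= t -> 1 - p i i t <= - q i i * t.
Proof.
rewrite le_eqVlt => /predU1P[<-|t0].
  by rewrite transition_at0// eqxx subrr mulr0.
have u0 n : 0 < t / n.+1%:R by rewrite divr_gt0.
(* Sample the derivative at 0 along the times t / (n + 1). *)
have : (p i i (t / n.+1%:R) - (i == i)%:R) / (t / n.+1%:R) @[n --> \oo] --> q i i.
  have /cvg_at_rightP := @pq i i; apply; split => //.
  rewrite -[X in _ --> X](mulr0 t); apply: cvgMr.
  exact: cvg_harmonic.
move=> H; rewrite mulrC mulrN -mulNr.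
apply: (cvgr_to_ge (cvgM (cvg_cst (- t)) H)); apply: nearW => n.
rewrite /= eqxx.
have := transition_diag_subadditive i n.+1 (ltW (u0 n)).
rewrite [_ * (t / _)]mulrC divfK ?pnatr_eq0//.
move=> /le_trans; apply.
rewrite mulr1n le_eqVlt; apply/orP; left; apply/eqP.
move: (p i i _) => P; field.
by rewrite (gt_eqF t0) andbT addrC natr1 pnatr_eq0.
Qed.

(** Condition on the first step of length h: with probability p_ii(h) nothing has
    changed, and the complementary event has probability at most - q_ii h. *)
Lemma transition_lipschitz i j : halfline_lipschitz (- q i i) (p i j).
Proof.
move=> s h s0 h0; rewrite ler_distl [s + h]addrC.
have /andP[a0 a1] := transition_unit_valued i j s0.
have /andP[b0 b1] := transition_unit_valued i i h0.
have d := transition_diag_ge i h0.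
apply/andP; split.
  apply: le_trans (chapman_kolmogorov_ge i j i h0 s0).
  have : 0 <= (1 - p i i h) * (1 - p i j s) by rewrite mulr_ge0 ?subr_ge0.
  rewrite mulrBl mulrBr; lra.
apply: (cvgr_to_le (@chapman_kolmogorov_cvg i j _ _ h0 s0)).
exists i.+1 => // n /= ni.
rewrite /series/= big_mkord (bigD1 (Ordinal ni))//=.
have := transition_sum_le1 i n h0.
rewrite big_mkord (bigD1 (Ordinal ni))//= => Hs.
have : \sum_(k < n | k != Ordinal ni) p i k h * p k j s <=
  \sum_(k < n | k != Ordinal ni) p i k h.
  apply: ler_sum => k _; rewrite ler_piMr ?p0//.
  by case/andP: (transition_unit_valued k j s0).
have : p i i h * p i j s <= p i j s by rewrite ler_piMl.
lra.
Qed.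

Variables (lambda : R).
Hypothesis lambda0 : 0 < lambda.
Local Notation phi := (resolvent p lambda).

Lemma resolvent_ge0 i j : 0 <= phi i j.
Proof. exact: laplace_ge0 (transition_unit_valued i j). Qed.

Lemma resolvent_sum_le i n : \sum_(0 <= j < n) phi i j <= lambda^-1.
Proof.
apply: (laplace_sum_le lambda0 (M := fun=> - q i i)).
- by move=> k; exact: transition_lipschitz.
- by move=> k; exact: transition_unit_valued.
- by move=> t; exact: transition_sum_le1.
Qed.

Lemma resolvent_series_cvg i : cvgn (series (phi i)).
Proof.
apply: nondecreasing_is_cvgn.
  by apply: series_ge0_nondecreasing; exact: resolvent_ge0.
by exists lambda^-1 => _ [n _ <-]; exact: resolvent_sum_le.
Qed.

(** The transform in t of the Chapman-Kolmogorov equation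
    p_ij(t + h) = sum_k p_ik(t) p_kj(h). *)
Lemma resolvent_shift_cvg i j h : 0 <= h ->
  series (fun k => phi i k * p k j h) @ \oo -->
  laplace lambda (fun t => p i j (t + h)).
Proof.
move=> h0.
rewrite (_ : (fun k => _) =
    (fun k => laplace lambda (fun t => p i k t * p k j h))); last first.
  apply/funext => k.
  exact/esym/(laplaceZr lambda0 _ (@transition_lipschitz i k))/transition_unit_valued.
have f1 k : unit_valued (fun t => p i k t * p k j h).
  move=> t t0; rewrite mulr_ge0 ?p0//=.
  have /andP[? ?] := transition_unit_valued i k t0.
  have /andP[? ?] := transition_unit_valued k j h0.
  by rewrite mulr_ile1.
apply: nneseries_cvg; first by move=> k; exact: laplace_ge0.
apply: (laplace_series lambda0 (M := fun=> - q i i) (N := - q i i)) => //.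
- move=> k s l s0 l0; rewrite -mulrBl normrM.
  apply: le_trans (transition_lipschitz i k s0 l0).
  rewrite ler_piMr// ger0_norm ?p0//.
  by case/andP: (transition_unit_valued k j h0).
- move=> s l s0 l0; rewrite addrAC transition_lipschitz// addr_ge0//.
- by move=> s s0; rewrite transition_unit_valued// addr_ge0.
- by move=> t t0; exact: transition_chapman_kolmogorov.
Qed.

(** For k >= n > j the entry p_kj(h) is off the diagonal, hence at most M h. The
    factor h survives the division by h in the forward equation, which makes the
    truncation uniform in h. *)
Lemma forward_truncation M i j h n : (forall k, - q k k <= M) ->
  0 <= h -> (j < n)%N ->
  `|laplace lambda (fun t => p i j (t + h)) - series (fun k => phi i k * p k j h) n|
   <= M * h * (limn (series (phi i)) - series (phi i) n).
Proof.
move=> qM h0 jn.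
have M0 : 0 <= M.
  by apply: le_trans (halfline_lipschitz_ge0 (transition_lipschitz 0 0)) (qM 0).
have t0 k : 0 <= phi i k * p k j h by rewrite mulr_ge0 ?resolvent_ge0 ?p0.
have C := @resolvent_shift_cvg i j h h0.
rewrite ger0_norm ?subr_ge0 ?(series_ge0_le_lim _ t0 C)//.
rewrite lerBlDr; apply: (cvgr_to_le C); exists n => // m /= nm.
rewrite -lerBlDr sub_series_geq//.
apply: (@le_trans _ _ (\sum_(n <= k < m) phi i k * (M * h))).
  apply: ler_sum_nat => k /andP[nk _]; rewrite ler_wpM2l ?resolvent_ge0//.
  have kj : k != j by rewrite gtn_eqF// (leq_trans jn).
  apply: (le_trans (transition_off_diag kj h0)).
  by apply: (le_trans (transition_diag_ge k h0)); rewrite ler_wpM2r.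
rewrite -mulr_suml mulrC ler_wpM2l ?mulr_ge0//.
rewrite -sub_series_geq// lerD2r.
apply: series_ge0_le_lim; [exact: resolvent_ge0|exact: resolvent_series_cvg].
Qed.

(** For fixed n the truncated sum may be differentiated at h = 0 term by term;
    the truncation error, divided by h, is at most M times the tail of the
    convergent series of the resolvent entries. *)
Theorem forward_resolvent_cvg M i j : (forall k, - q k k <= M) ->
  series (fun k => phi i k * q k j) @ \oo --> lambda * phi i j - (i == j)%:R.
Proof.
move=> qM.
pose T n := limn (series (phi i)) - series (phi i) n.
have T0 : M * T n @[n --> \oo] --> (0:R).
  rewrite -[X in _ --> X](mulr0 M); apply: cvgMr.
  rewrite /T -[X in _ --> X](subrr (limn (series (phi i)))).
  by apply: cvgB; [exact: cvg_cst|exact: resolvent_series_cvg].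
apply/cvgrPdist_le => e e0.
have /cvgrPdist_le/(_ _ e0) := T0.
case=> N _ HN; exists (maxn N j.+1) => // n /=; rewrite geq_max => /andP[Nn jn].
apply: (@le_trans _ _ (M * T n)); last first.
  by apply: le_trans (HN n Nn); rewrite sub0r normrN ler_norm.
(* Letting h decrease to 0 at fixed n, the bound on the truncation error persists. *)
have lim : (laplace lambda (fun t => p i j (t + h)) - phi i j) / h -
    \sum_(0 <= k < n) phi i k * ((p k j h - (k == j)%:R) / h) @[h --> 0^'+] -->
    lambda * phi i j - (i == j)%:R - \sum_(0 <= k < n) phi i k * q k j.
  apply: cvgB.
    rewrite -(transition_at0 pT i j).
    exact: laplace_slope_cvg (transition_lipschitz i j) (@transition_unit_valued i j).
  apply: cvg_big => [|k _]; first exact: add_continuous.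
  by apply: cvgMr; exact: pq.
apply: (cvgr_to_le (cvg_norm lim)); near=> h.
have h0 : 0 < h by [].
have := forward_truncation i qM (ltW h0) jn.
rewrite mulrAC -ler_pdivrMr// -/(T n); apply: le_trans.
rewrite -[X in _ <= _ / X](gtr0_norm h0) -normf_div.
rewrite le_eqVlt; apply/orP; left; apply/eqP; congr `|_|.
have -> : \sum_(0 <= k < n) phi i k * ((p k j h - (k == j)%:R) / h) =
   (series (fun k => phi i k * p k j h) n - phi i j) / h.
  have -> : phi i j = \sum_(0 <= k < n) phi i k * (k == j)%:R.
    rewrite big_mkord (bigD1 (Ordinal jn))//= eqxx mulr1 big1 ?addr0//.
    by move=> k /negPf; rewrite -val_eqE/= => ->; rewrite mulr0.
  rewrite /series/= -sumrB mulr_suml; apply: eq_bigr => k _.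
  by rewrite mulrA mulrBr.
by rewrite -mulrBl; congr (_ / _); ring.
Unshelve. all: by end_near. Qed.

End transition.

(** * The generating function of the batch rates *)

Section batch_rates.
Context {R : realType}.
Variable b : nat -> R.
Hypothesis bR : batch_rates b.

(** The rates with the diagonal one removed, so that the general facts on
    nonnegative series apply. *)
Let batch j : R := if j == 1%N then 0 else b j.

Let batch_ge0 j : 0 <= batch j.
Proof. by rewrite /batch; case: eqP => // /eqP; exact: batch_rates_ge0. Qed.

Let batch_sum_le n : \sum_(0 <= j < n) batch j <= - b 1%N.
Proof.
apply: nneseries_le_sum => //.
rewrite -(batch_rates_conservative bR) [leRHS]eseries_mkcond.
rewrite le_eqVlt; apply/orP; left; apply/eqP/eq_eseriesr => j _.
by rewrite /batch; case: eqP.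
Qed.

(** The rates sum to 0 and [b 1] is the only negative one, so a partial sum that
    includes [b 1] falls short of 0. *)
Lemma batch_rates_sum_le0 n : \sum_(0 <= j < n.+2) b j <= 0.
Proof.
have -> : \sum_(0 <= j < n.+2) b j = \sum_(0 <= j < n.+2) batch j + b 1%N.
  by rewrite !big_nat_recl//= /batch/=; ring.
by rewrite -lerBrDr sub0r.
Qed.

Lemma batch_rates_tail_le m n : (2 <= m)%N ->
  \sum_(m <= j < n) b j <= - b 1%N.
Proof.
move=> m2; apply: le_trans (batch_sum_le n).
have [nm|/ltnW mn] := leqP n m; first by rewrite big_geq// sumr_ge0.
rewrite [leRHS](big_cat_nat (n := m))//=.
rewrite -[leLHS]add0r; apply: lerD; first exact: sumr_ge0.
apply: ler_sum_nat => j /andP[mj _].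
by rewrite /batch gtn_eqF// (leq_trans m2 mj).
Qed.

Section power_series.
Variable u : R.
Hypothesis u01 : 0 <= u <= 1.

Lemma pseries_batch_rates_cvg : cvgn (pseries b u).
Proof.
have [u0 u1] := andP u01.
apply: normed_cvg; apply: nondecreasing_is_cvgn.
  exact: (@series_ge0_nondecreasing _ (fun j => `|b j * u ^+ j|)).
exists (- b 1%N - b 1%N) => _ [n _ <-].
apply: (@le_trans _ _ (series (fun j => `|b j * u ^+ j|) n.+2)).
  apply: (series_ge0_nondecreasing (fun j => normr_ge0 _)).
  exact: leq_trans (leqnSn n) (leqnSn n.+1).
apply: (@le_trans _ _ (\sum_(0 <= j < n.+2) (batch j - (j == 1%N)%:R * b 1%N))).
  apply: ler_sum_nat => j _.
  rewrite normrM (ger0_norm (exprn_ge0 _ u0)).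
  apply: (@le_trans _ _ `|b j|); first by rewrite ler_piMr// exprn_ile1.
  have [->|j1] := eqVneq j 1%N.
    by rewrite /batch eqxx add0r mul1r ltr0_norm// -oppr_gt0 batch_rates_1.
  by rewrite mul0r subr0 /batch (negPf j1) ger0_norm// batch_rates_ge0.
rewrite sumrB lerD ?batch_sum_le// -mulr_suml lerN2.
by rewrite !big_nat_recl//= big1// add0r addr0 mul1r.
Qed.

(** The factor [u ^+ n] is what makes the error of the summed columns geometrically
    small. *)
Lemma genfun_tail n : (2 <= n)%N ->
  0 <= genfun b u - \sum_(0 <= j < n) b j * u ^+ j <= u ^+ n * - b 1%N.
Proof.
move=> n2; have [u0 u1] := andP u01.
have bu j : (n <= j)%N -> 0 <= b j * u ^+ j <= b j * u ^+ n.
  move=> nj; have bj : 0 <= b j by apply: batch_rates_ge0 => //; lia.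
  by rewrite mulr_ge0 ?exprn_ge0//= ler_wpM2l// ler_wiXn2l.
rewrite subr_ge0 lerBlDr; apply/andP; split.
  apply: limr_ge; first exact: pseries_batch_rates_cvg.
  exists n => // m /= nm; rewrite -subr_ge0 sub_series_geq//.
  rewrite big_nat_cond sumr_ge0// => j /andP[/andP[nj _] _].
  by case/andP: (bu j nj).
apply: limr_le; first exact: pseries_batch_rates_cvg.
exists n => // m /= nm; rewrite -lerBlDr sub_series_geq//.
apply: (@le_trans _ _ (\sum_(n <= j < m) b j * u ^+ n)).
  by apply: ler_sum_nat => j /andP[nj _]; case/andP: (bu j nj).
by rewrite -mulr_suml mulrC ler_wpM2l ?exprn_ge0// batch_rates_tail_le.
Qed.

End power_series.

Lemma genfun1_le0 : genfun b 1 <= 0.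
Proof.
apply: limr_le; first by apply: pseries_batch_rates_cvg; rewrite ler01 lexx.
exists 2%N => // -[|[|n]]// _; rewrite /pseries/series/=.
by under eq_bigr do rewrite expr1n mulr1; exact: batch_rates_sum_le0.
Qed.

(** At 1 the function U equals the sum of the rates minus lambda, which is
    negative. *)
Lemma root_lt1 c lambda u : 0 < lambda -> 0 <= u <= 1 ->
  U c b lambda u = 0 -> u < 1.
Proof.
move=> lambda0 /andP[u0 u1] Uu; rewrite lt_neqAle u1 andbT.
apply/eqP => u1'; move: Uu; rewrite u1' /U /genfun_servers subrr mulr0 addr0 mulr1.
have := genfun1_le0; lra.
Qed.

End batch_rates.

(** * The queue and its linear system *)

Section queue.
Context {R : realType}.
Variables (c : nat) (b : nat -> R).
Local Notation q := (queue_qmatrix c b).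

Lemma queue_qmatrix_below k j : (j.+1 < k)%N -> q k j = 0.
Proof.
move=> jk; have kj : (j < k)%N := ltnW jk.
rewrite /queue_qmatrix (gtn_eqF (leq_ltn_trans (leq0n j) kj)).
by rewrite (gtn_eqF jk) (gtn_eqF kj) ltnNge ltnW.
Qed.

Lemma queue_qmatrix_0 j : q 0%N j = 0. Proof. by []. Qed.

Lemma queue_qmatrix_down k : q k.+1 k = (minn k.+1 c)%:R * b 0%N.
Proof. by rewrite /queue_qmatrix/= eqxx. Qed.

Lemma queue_qmatrix_diag k : q k.+1 k.+1 = b 1%N - ((minn k.+1 c)%:R - 1) * b 0%N.
Proof. by rewrite /queue_qmatrix/= ltn_eqF// eqxx. Qed.

Lemma queue_qmatrix_up k j : (0 < k < j)%N -> q k j = b (j - k + 1)%N.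
Proof.
move=> /andP[k0 kj]; rewrite /queue_qmatrix gtn_eqF//.
by rewrite ltn_eqF ?(leqW kj)// ltn_eqF// kj.
Qed.

(** Column N cuts the row of state k + 1 after its first N - k + 1 entries. In the
    limit this reads s^k B_m(s) with m = min(k + 1, c). *)
Lemma queue_row_genfun N k s : (k < N)%N ->
  \sum_(0 <= j < N.+1) q k.+1 j * s ^+ j =
  s ^+ k * (\sum_(0 <= j < (N - k).+1) b j * s ^+ j +
    ((minn k.+1 c)%:R - 1) * b 0%N * (1 - s)).
Proof.
move=> kN; have -> : N.+1 = (k + (N - k.+1).+2)%N by lia.
rewrite (big_cat_nat (n := k)) ?leq_addr//= big_nat_cond big1 ?add0r; last first.
  by move=> j /andP[/andP[_ jk] _]; rewrite queue_qmatrix_below ?mul0r.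
rewrite -{1}[k]add0n big_addn addKn.
have -> : (N - k).+1 = (N - k.+1).+2 by lia.
rewrite !big_nat_recl//.
rewrite add0n queue_qmatrix_down add1n queue_qmatrix_diag.
rewrite (eq_big_nat _ _ (F2 := fun j => s ^+ k * (b j.+2 * s ^+ j.+2))); last first.
  move=> j _; rewrite queue_qmatrix_up; last lia.
  rewrite exprD; have -> : (j.+2 + k - k.+1 + 1 = j.+2)%N by lia.
  by ring.
by rewrite -mulr_sumr exprS expr0 expr1; ring.
Qed.

(** Summing the columns 0, .., N of the forward equation with weights s^j. State
    N + 1 contributes only its departure to N, and higher states contribute
    nothing. Used at s = u for the equation of the root, and at s = 1 for the
    positivity behind uniqueness. *)
Lemma forward_truncated_genfun (x : nat -> R) (a : nat -> R) N s :
  (forall j, (j <= N)%N -> \sum_(0 <= k < j.+2) x k * q k j = a j) ->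
  \sum_(0 <= j < N.+1) a j * s ^+ j =
  \sum_(0 <= k < N) x k.+1 * (s ^+ k * (\sum_(0 <= j < (N - k).+1) b j * s ^+ j +
    ((minn k.+1 c)%:R - 1) * b 0%N * (1 - s))) +
  x N.+1 * ((minn N.+1 c)%:R * b 0%N * s ^+ N).
Proof.
move=> xa.
transitivity (\sum_(0 <= k < N.+2) x k * (\sum_(0 <= j < N.+1) q k j * s ^+ j)).
  under [RHS]eq_bigr do rewrite mulr_sumr.
  rewrite exchange_big_nat/=; apply: eq_big_nat => j /andP[_ jN].
  rewrite -xa// mulr_suml [RHS](big_cat_nat (n := j.+2))//=.
  under eq_bigr do rewrite -mulrA.
  rewrite [X in _ = _ + X]big_nat_cond [X in _ = _ + X]big1 ?addr0// => k.
  by move=> /andP[/andP[jk _] _]; rewrite queue_qmatrix_below ?mul0r ?mulr0.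
rewrite big_nat_recl// big1 ?mulr0 ?add0r; last by move=> j _; rewrite mul0r.
rewrite big_nat_recr//=; congr (_ + _).
  by apply: eq_big_nat => k /andP[_ kN]; rewrite queue_row_genfun.
congr (_ * _); rewrite big_nat_recr//= queue_qmatrix_down.
rewrite big_nat_cond big1 ?add0r// => j /andP[/andP[_ jN] _].
by rewrite queue_qmatrix_below ?mul0r.
Qed.

Lemma queue_column (x : nat -> R) j : (1 <= j)%N -> (j + 2 <= c)%N ->
  \sum_(0 <= k < j.+2) x k * q k j =
  \sum_(1 <= k < j) x k * b (j - k + 1)%N
  + (b 1%N - (j%:R - 1) * b 0%N) * x j + (j + 1)%:R * b 0%N * x (j + 1)%N.
Proof.
move=> j1 jc; rewrite !big_nat_recr//= big_ltn// queue_qmatrix_0 mulr0 add0r.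
case: j j1 jc => // j _ jc.
rewrite queue_qmatrix_down queue_qmatrix_diag (minn_idPl _); last lia.
rewrite (minn_idPl _); last lia.
rewrite !addn1 ![_ * x _]mulrC; congr (_ + _ + _).
by apply: eq_big_nat => k /andP[k1 kj]; rewrite queue_qmatrix_up ?k1// addn1.
Qed.

Lemma queue_column0 (x : nat -> R) : (2 <= c)%N ->
  \sum_(0 <= k < 2) x k * q k 0%N = b 0%N * x 1%N.
Proof.
move=> c2; rewrite big_nat_recr//= big_nat1 queue_qmatrix_0 mulr0 add0r.
by rewrite queue_qmatrix_down (minn_idPl _) ?mul1r 1?mulrC//; lia.
Qed.

Lemma genfun_servers_diff k s :
  genfun_servers b c s - genfun_servers b k s = (c%:R - k%:R) * b 0%N * (1 - s).
Proof. by rewrite /genfun_servers; ring. Qed.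

Definition root_equation lambda u i (x : nat -> R) :=
  - lambda * x 0%N - \sum_(1 <= k < c)
     u ^+ (k - 1) * (genfun_servers b c u - genfun_servers b k u) * x k
  = - u ^+ i.

(** The equations of the system other than that of the root, in the uniform shape
    of the forward equation. *)
Definition column_equations lambda i n (x : nat -> R) :=
  forall j, (j < n)%N ->
    \sum_(0 <= k < j.+2) x k * q k j = lambda * x j - (i == j)%:R.

Lemma solves_systemP lambda u i (x : c.-tuple R) :
  solves_system b lambda u i x <->
  root_equation lambda u i (nth 0 x) /\ column_equations lambda i c.-1 (nth 0 x).
Proof.
split=> [[xr x0 xj]|[xr xj]]; split => //.
- move=> [c2'|j jc].
    have c2 : (2 <= c)%N by lia.
    rewrite queue_column0//; have := x0 c2; lra.
  have j1 : (1 <= j.+1)%N by [].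
  have j2 : (j.+1 + 2 <= c)%N by lia.
  rewrite queue_column//; have := xj _ j1 j2.
  rewrite !mulrBl; lra.
- move=> c2; have := xj 0%N; rewrite queue_column0// => /(_ ltac:(lia)); lra.
- move=> j j1 jc; have := xj j; rewrite queue_column// => /(_ ltac:(lia)).
  rewrite !mulrBl; lra.
Qed.

Hypothesis c1 : (1 <= c)%N.
Hypothesis bR : batch_rates b.

Let b0 : 0 < b 0%N := batch_rates_0 bR.

Lemma queue_qmatrix_bounded k : - q k k <= c%:R * b 0%N - b 1%N.
Proof.
have b1 := batch_rates_1 bR.
rewrite /queue_qmatrix; case: eqP => _.
  by rewrite oppr0 addr_ge0 ?ltW// mulr_gt0// ltr0n.
rewrite ltn_eqF// eqxx.
have : (minn k c)%:R * b 0%N <= c%:R * b 0%N.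
  by rewrite ler_pM2r// ler_nat geq_minr.
have := b0; rewrite mulrBl mul1r; lra.
Qed.

(** The quantity E below, which does not depend on N, is the error of the equation
    after summing the columns 0, .., N; it is at most K u^N for all large N, hence
    it vanishes. *)
Lemma forward_root_equation lambda u i (x : nat -> R) :
  0 < lambda -> 0 <= u <= 1 -> U c b lambda u = 0 ->
  (forall k, 0 <= x k) ->
  (forall n, \sum_(0 <= k < n) x k <= lambda^-1) ->
  (forall n, column_equations lambda i n x) ->
  root_equation lambda u i x.
Proof.
move=> lambda0 u01 Uu xge0 xs xc.
have xb k : 0 <= x k <= lambda^-1.
  by rewrite xge0/=; apply: le_trans (xs k.+1); exact: ge0_le_sum.
have [u0 _] := andP u01; have u1 := root_lt1 bR lambda0 u01 Uu.
have b1 := batch_rates_1 bR.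
have Bc : genfun_servers b c u = lambda * u.
  by apply/eqP; rewrite -subr_eq0; apply/eqP.
pose d k := u ^+ k * (genfun_servers b c u - genfun_servers b k.+1 u) * x k.+1.
pose E := lambda * x 0%N + \sum_(0 <= k < c.-1) d k - u ^+ i.
suff E0 : E = 0.
  rewrite /root_equation (big_addn 0 c 1) subn1.
  rewrite (eq_bigr d); last by move=> k _; rewrite addnK addn1.
  by move: E0; rewrite /E; lra.
(* The first term bounds the departures from N + 1, the second the arrivals
   beyond N. *)
pose K := lambda^-1 * (c%:R * b 0%N) + lambda^-1 * - b 1%N.
have Eb N : (maxn c i <= N)%N -> `|E| <= K * u ^+ N.
  rewrite geq_max => /andP[cN iN].
  have := @forward_truncated_genfun x (fun j => lambda * x j - (i == j)%:R) N u.
  move=> /(_ (fun j _ => xc j.+1 j (ltnSn j))).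
  (* What the truncation at column N removes from the row of state k + 1. *)
  pose r k := genfun b u - \sum_(0 <= j < (N - k).+1) b j * u ^+ j.
  under eq_bigr => j _ do rewrite mulrBl.
  rewrite sumrB [X in _ - X](_ : _ = u ^+ i); last first.
    rewrite big_mkord (bigD1 (Ordinal (iN : (i < N.+1)%N)))//= eqxx mul1r.
    rewrite big1 ?addr0// => j; rewrite -val_eqE/= eq_sym => /negPf ->.
    by rewrite mul0r.
  rewrite big_nat_recl// expr0 mulr1.
  rewrite [X in _ = X + _](_ : _ = \sum_(0 <= k < N) lambda * x k.+1 * u ^+ k.+1
     - \sum_(0 <= k < c.-1) d k -
     \sum_(0 <= k < N) x k.+1 * (u ^+ k * r k)); last first.
    have -> : \sum_(0 <= k < c.-1) d k = \sum_(0 <= k < N) u ^+ k *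
       (genfun_servers b c u - genfun_servers b (minn k.+1 c) u) * x k.+1.
      rewrite [RHS](big_cat_nat (n := c.-1))//=; last lia.
      rewrite [X in _ = _ + X]big_nat_cond [X in _ = _ + X]big1 ?addr0; last first.
        move=> k /andP[/andP[ck _] _]; rewrite (minn_idPr _); last lia.
        by rewrite subrr mulr0 mul0r.
      by apply: eq_big_nat => k /andP[_ kc]; rewrite (minn_idPl _)//; lia.
    rewrite -!sumrB; apply: eq_bigr => k _.
    rewrite Bc /r /genfun_servers exprS; ring.
  move=> eqN.
  have -> : E = x N.+1 * ((minn N.+1 c)%:R * b 0%N * u ^+ N) -
      \sum_(0 <= k < N) x k.+1 * (u ^+ k * r k).
    by rewrite /E; lra.
  apply: le_trans (ler_normB _ _) _; rewrite mulrDl lerD//.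
    rewrite ger0_norm; last first.
      by rewrite !mulr_ge0 ?exprn_ge0 ?(ltW b0).
    rewrite mulrA ler_wpM2r ?exprn_ge0// ler_pM//.
    - by rewrite mulr_ge0// (ltW b0).
    - by case/andP: (xb N.+1).
    - by rewrite ler_wpM2r ?(ltW b0)// ler_nat geq_minr.
  have rb k : (k < N)%N -> 0 <= u ^+ k * r k <= u ^+ N * - b 1%N.
    move=> kN; have n2 : (2 <= (N - k).+1)%N by lia.
    have /andP[r0 r1] := genfun_tail bR u01 n2.
    rewrite mulr_ge0 ?exprn_ge0//=.
    apply: (@le_trans _ _ (u ^+ k * (u ^+ (N - k).+1 * - b 1%N))).
      by rewrite ler_wpM2l ?exprn_ge0.
    rewrite mulrA -exprD ler_wpM2r ?(ltW b1)//.
    rewrite ler_wiXn2l ?(ltW u1)//; lia.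
  rewrite ger0_norm; last first.
    rewrite big_nat_cond sumr_ge0// => k /andP[/andP[_ kN] _].
    by rewrite mulr_ge0//; case/andP: (rb k kN).
  apply: (@le_trans _ _ (\sum_(0 <= k < N) x k.+1 * (u ^+ N * - b 1%N))).
    apply: ler_sum_nat => k /andP[_ kN].
    by rewrite ler_wpM2l//; case/andP: (rb k kN).
  rewrite -mulr_suml -mulrA [- b 1%N * _]mulrC ler_wpM2r//.
    by rewrite mulr_ge0 ?exprn_ge0// ltW.
  by have := xs N.+1; rewrite big_nat_recl//; apply: le_trans; rewrite lerDr.
apply/eqP; rewrite -normr_le0.
have K0 : K * u ^+ N @[N --> \oo] --> (0:R).
  rewrite -[X in _ --> X](mulr0 K); apply: cvgMr; apply: cvg_expr.
  by rewrite ger0_norm.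
by apply: (cvgr_to_ge K0); exists (maxn c i) => // N /= /Eb.
Qed.

(** Adding the columns 0, .., J: the states 1, .., J enter with a coefficient
    b_0 + .. + b_n <= 0 with n >= 1, so the positive departure rate from J + 1
    multiplies a nonnegative number. *)
Lemma homogeneous_columns_ge0 lambda (z : nat -> R) :
  0 < lambda -> 0 <= z 0%N ->
  (forall j, (j < c.-1)%N ->
    \sum_(0 <= k < j.+2) z k * q k j = lambda * z j) ->
  forall k, (k < c)%N -> 0 <= z k.
Proof.
move=> lambda0 z0 zc; elim/ltn_ind => -[//|J] IH Jc.
have := @forward_truncated_genfun z (fun j => lambda * z j) J 1.
have zJ j : (j <= J)%N -> \sum_(0 <= k < j.+2) z k * q k j = lambda * z j.
  by move=> jJ; apply: zc; lia.
move=> /(_ zJ); rewrite (minn_idPl _) ?(ltnW Jc)//.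
rewrite subrr !expr1n mulr1 => eqJ.
have Sz : 0 <= \sum_(0 <= j < J.+1) lambda * z j * 1 ^+ j.
  rewrite big_nat_cond sumr_ge0// => j /andP[/andP[_ jJ] _].
  rewrite expr1n mulr1 mulr_ge0 ?(ltW lambda0)// IH//; lia.
have Sb : \sum_(0 <= k < J) z k.+1 * (1 ^+ k * (\sum_(0 <= j < (J - k).+1)
    b j * 1 ^+ j + ((minn k.+1 c)%:R - 1) * b 0%N * 0)) <= 0.
  rewrite big_nat_cond -oppr_ge0 -sumrN sumr_ge0// => k /andP[/andP[_ kJ] _].
  rewrite oppr_ge0 mulr0 addr0 expr1n mul1r mulr_ge0_le0//; first by apply: IH; lia.
  under eq_bigr do rewrite expr1n mulr1.
  have -> : (J - k).+1 = (J - k.+1).+2 by lia.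
  exact: batch_rates_sum_le0.
have J0 : 0 < J.+1%:R * b 0%N by rewrite mulr_gt0.
rewrite -(pmulr_lge0 _ J0) mulrC; lra.
Qed.

(** Changing the sign of z if necessary, z_0 >= 0. The equation of the root then
    forces z_0 = 0, after which positivity applies to both z and - z. *)
Lemma homogeneous_system_eq0 lambda u (z : nat -> R) :
  0 < lambda -> 0 <= u <= 1 ->
  lambda * z 0%N + \sum_(1 <= k < c)
     u ^+ (k - 1) * (genfun_servers b c u - genfun_servers b k u) * z k = 0 ->
  (forall j, (j < c.-1)%N ->
    \sum_(0 <= k < j.+2) z k * q k j = lambda * z j) ->
  forall k, (k < c)%N -> z k = 0.
Proof.
move=> lambda0 /andP[u0 u1].
have opp_columns (y : nat -> R) :
    (forall j, (j < c.-1)%N -> \sum_(0 <= k < j.+2) y k * q k j = lambda * y j) ->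
    forall j, (j < c.-1)%N ->
      \sum_(0 <= k < j.+2) - y k * q k j = lambda * - y j.
  move=> yc j jc; rewrite mulrN -yc// -sumrN.
  by apply: eq_bigr => k _; rewrite mulNr.
wlog z0 : z / 0 <= z 0%N => [wlg zr zc k kc|zr zc].
  have [/wlg|/ltW z0] := leP 0 (z 0%N); first exact.
  apply/oppr_inj; rewrite oppr0.
  apply: (wlg (fun k => - z k)) => //; first by rewrite oppr_ge0.
  - under eq_bigr do rewrite mulrN.
    by rewrite mulrN sumrN -opprD zr oppr0.
  - exact: opp_columns.
have zge0 := homogeneous_columns_ge0 lambda0 z0 zc.
have z00 : z 0%N = 0.
  apply/eqP; rewrite eq_le z0 andbT -(pmulr_rle0 _ lambda0).
  suff : 0 <= \sum_(1 <= k < c)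
     u ^+ (k - 1) * (genfun_servers b c u - genfun_servers b k u) * z k by lra.
  rewrite big_nat_cond sumr_ge0// => k /andP[/andP[_ kc] _].
  rewrite genfun_servers_diff !mulr_ge0 ?exprn_ge0 ?zge0 ?subr_ge0//.
    by rewrite ler_nat ltnW.
  by rewrite ltW.
have Nzge0 : forall k, (k < c)%N -> 0 <= - z k.
  by apply: homogeneous_columns_ge0 (opp_columns _ zc) => //; rewrite z00 oppr0.
by move=> k kc; apply/eqP; rewrite eq_le zge0// -oppr_ge0 Nzge0.
Qed.

Lemma solves_system_unique lambda u i (x y : c.-tuple R) :
  0 < lambda -> 0 <= u <= 1 ->
  solves_system b lambda u i x -> solves_system b lambda u i y -> x = y.
Proof.
move=> lambda0 u01 /solves_systemP[xr xc] /solves_systemP[yr yc].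
apply: val_inj; apply: (@eq_from_nth _ 0) => [|k]; rewrite ?size_tuple// => kc.
apply/eqP; rewrite -subr_eq0; apply/eqP.
apply: (homogeneous_system_eq0 (z := fun k => x`_k - y`_k) lambda0 u01) => //.
- under eq_bigr do rewrite mulrBr.
  move: xr yr; rewrite sumrB /root_equation mulrBr; lra.
- move=> j jc; under eq_bigr do rewrite mulrBl.
  by rewrite sumrB xc// yc//; ring.
Qed.

End queue.

Theorem theorem2p1 (R : realType) (c : nat) (b : nat -> R)
    (p : nat -> nat -> R -> R) (lambda u : R) (i : nat) :
  (1 <= c)%N ->
  batch_rates b ->
  transition_function p ->
  has_qmatrix p (queue_qmatrix c b) ->
  0 < lambda ->
  0 <= u <= 1 -> U c b lambda u = 0 ->
  unique (solves_system (c := c) b lambda u i)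
    [tuple resolvent p lambda i j | j < c].
Proof.
move=> c1 bR pT pq lambda0 u01 Uu.
pose x := resolvent p lambda i.
have xc n : column_equations c b lambda i n x.
  move=> j _; have C := @forward_resolvent_cvg _ _ _ pT pq _ lambda0 _ i j
    (queue_qmatrix_bounded c1 bR).
  rewrite -(cvg_lim (@Rhausdorff R) C); apply/esym/lim_near_cst => //.
  exists j.+2 => // m /= jm; rewrite /series/= (big_cat_nat (n := j.+2))//=.
  rewrite [X in _ + X]big_nat_cond [X in _ + X]big1 ?addr0// => k.
  by move=> /andP[/andP[jk _] _]; rewrite queue_qmatrix_below ?mulr0.
have xs n : \sum_(0 <= k < n) x k <= lambda^-1.
  exact: (resolvent_sum_le pT pq lambda0).
have x0 k : 0 <= x k := resolvent_ge0 pT lambda i k.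
have nthx k : (k < c)%N -> [tuple x j | j < c]`_k = x k.
  by move=> kc; rewrite -[k in LHS]/(nat_of_ord (Ordinal kc)) nth_mktuple.
have sol : solves_system b lambda u i [tuple x j | j < c].
  apply/solves_systemP; split.
    rewrite /root_equation nthx//.
    have := forward_root_equation c1 bR lambda0 u01 Uu x0 xs xc.
    rewrite /root_equation => <-; congr (_ - _).
    by apply: eq_big_nat => k /andP[_ kc]; rewrite nthx.
  move=> j jc; rewrite nthx; last lia.
  rewrite -(xc c.-1 j jc); apply: eq_big_nat => k /andP[_ kj]; rewrite nthx//; lia.
split=> // y; exact: (solves_system_unique c1 bR lambda0 u01 sol).
Qed.
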